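(* Let $(X,f_s)$ be a structured space with $X$ nonempty, let $\mathcal{U}$ be the domain of $f_s$, let $h(x)=\{U\in\mathcal{U}: x\in U\}$, let $P=X/\!\sim$ be the poset associated to $X$, and let $\mathcal{F}:P^{op}\to\mathbf{Ab}$ be a presheaf of abelian groups on $P$. Then: (1) The higher limits $\varprojlim_P^{i}:=R^i\varprojlim_P$ (the right derived functors of the limit functor on presheaves of abelian groups on $P$) are defined, and hence the cohomology groups of $P$ with values in $\mathcal{F}$, $H^p(P,\mathcal{F}):=\varprojlim_P^{p}\mathcal{F}$, are defined for all $p\ge 0$. (2) Suppose moreover that $\mathcal{U}$ is finite and that $h:X\to\mathcal{L}$ is surjective, where $\mathcal{L}$ is the set of all nonempty subcollections of $\mathcal{U}$. Then the function $\mathrm{rk}:P\to\mathbb{Z}$, $\mathrm{rk}([x]):=|h(x)|$ (the cardinality of the collection $h(x)$), is a rank function on $P$ and is bounded above, so $P$ is a graded poset with a corank function. (3) Under the assumptions of (2), the cellular cohomology of $P$ with values in $\mathcal{F}$ is defined: the groups $C^n(P,\mathcal{F}):=HS^n(P^n,P^{n-1},\mathcal{F})$ together with the maps $\delta^n:C^n(P,\mathcal{F})\to C^{n+1}(P,\mathcal{F})$ described in the context satisfy $\delta^{n+1}\circ\delta^n=0$ for all $n\ge 0$, i.e. they form a cochain complex.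
   Context: Structured space: a topological space $X$ together with a collection $\mathcal{U}$ of subsets of $X$ covering $X$ (each point of $X$ lies in at least one member, the members being fixed neighborhoods of points of $X$) and a structure map $f_s$ with domain $\mathcal{U}$ assigning an algebraic structure to each member of $\mathcal{U}$. Only $X$ and $\mathcal{U}$ matter for this statement. The map $h$ sends $x\in X$ to $h(x)=\{U\in\mathcal{U}:x\in U\}$. Define $x\sim y$ iff $h(x)=h(y)$. The associated poset is $X/\!\sim$ with $[x]\le[y]$ iff $h(x)\subseteq h(y)$. A poset $P$ is regarded as a category with exactly one morphism $x\to y$ iff $x\le y$; a presheaf on $P$ is a functor $\mathcal{F}:P^{op}\to\mathbf{Ab}$. Write $x<y$ if $x\le y$ and $x\ne y$; write $x\prec z$ if $x<z$ and whenever $x\le y\le z$ then $y=x$ or $y=z$. A rank function on $P$ is a function $\mathrm{rk}:P\to\mathbb{Z}$ such that (i) $x<y$ implies $\mathrm{rk}(x)<\mathrm{rk}(y)$; (ii) $x\prec y$ implies $\mathrm{rk}(y)=\mathrm{rk}(x)+1$. A poset is graded if it has a rank function. If $\mathrm{rk}$ is bounded above and $r=\max_{x\in P}\mathrm{rk}(x)$, the corank function is $|x|:=r-\mathrm{rk}(x)$. Filtration: $P^k:=\{x\in P:|x|\le k\}$ for $k\ge 0$, and $P^{-1}:=\emptyset$. Presheaves on $P$ are restricted to the subposets $P^k$. Groups $HS^*$: for a poset $Q$ and a presheaf $\mathcal{F}$ on $Q$, let $S^n(Q,\mathcal{F})=\prod_{x_0\le x_1\le\dots\le x_n}\mathcal{F}(x_0)$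 with differential $(du)(x_0\le\dots\le x_{n+1})=\mathcal{F}(x_0\le x_1)\big(u(x_1\le\dots\le x_{n+1})\big)+\sum_{i=1}^{n+1}(-1)^i u(x_0\le\dots\le\widehat{x_i}\le\dots\le x_{n+1})$, and let $HS^n(Q,\mathcal{F})$ be its cohomology. For a subposet $Q'\subseteq Q$, $HS^n(Q,Q',\mathcal{F})$ is the cohomology of the kernel of the surjective restriction map $S^*(Q,\mathcal{F})\to S^*(Q',\mathcal{F})$. Coboundary: $\delta^n$ is the composite $HS^n(P^n,P^{n-1},\mathcal{F})\to HS^n(P^n,\mathcal{F})\to HS^{n+1}(P^{n+1},P^n,\mathcal{F})$, where the first map is induced by the inclusion of relative cochains and the second is the connecting homomorphism of the long exact sequence of the pair $(P^{n+1},P^n)$. *)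

(* Defs.v *)
From HB Require Import structures.
From mathcomp Require Import all_boot all_order all_algebra.
From mathcomp Require Import boolp classical_sets functions cardinality topology.
From mathcomp Require Import finmap zify.

Set Implicit Arguments.
Unset Strict Implicit.
Unset Printing Implicit Defensive.

Import Order.TTheory GRing.Theory Num.Theory.
Local Open Scope classical_set_scope.
Local Open Scope quotient_scope.
Local Open Scope ring_scope.

Definition dprod (I : Type) (V : I -> zmodType) : Type := forall i, V i.

Section DependentProduct.
Variables (I : Type) (V : I -> zmodType).

HB.instance Definition _ := gen_eqMixin (dprod V).
HB.instance Definition _ := gen_choiceMixin (dprod V).

Let dadd (f g : dprod V) : dprod V := fun i => f i + g i.
Let dopp (f : dprod V) : dprod V := fun i => - f i.
Let dzero : dprod V := fun=> 0.

Fact dprod_addA : associative dadd.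
Proof. by move=> f g h; apply: functional_extensionality_dep => i; exact: addrA. Qed.
Fact dprod_addC : commutative dadd.
Proof. by move=> f g; apply: functional_extensionality_dep => i; exact: addrC. Qed.
Fact dprod_add0 : left_id dzero dadd.
Proof. by move=> f; apply: functional_extensionality_dep => i; exact: add0r. Qed.
Fact dprod_addN : left_inverse dzero dopp dadd.
Proof. by move=> f; apply: functional_extensionality_dep => i; exact: addNr. Qed.

HB.instance Definition _ := GRing.isZmodule.Build (dprod V)
  dprod_addA dprod_addC dprod_add0 dprod_addN.

Lemma dprodP (f g : dprod V) : (forall i, f i = g i) -> f = g.
Proof. exact: functional_extensionality_dep. Qed.

Lemma dprodDE (f g : dprod V) i : (f + g) i = f i + g i. Proof. by []. Qed.
Lemma dprodNE (f : dprod V) i : (- f) i = - f i. Proof. by []. Qed.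
Lemma dprodBE (f g : dprod V) i : (f - g) i = f i - g i. Proof. by []. Qed.
Lemma dprod0E i : (0 : dprod V) i = 0. Proof. by []. Qed.

End DependentProduct.

Section Kernel.
Variables (V W : zmodType) (f : {additive V -> W}).

Definition ker_pred : {pred V} := fun x => f x == 0.

Fact ker_pred_closed : zmod_closed ker_pred.
Proof.
split=> [|x y]; rewrite !unfold_in /ker_pred ?raddf0 //.
by move=> /eqP fx /eqP fy; rewrite raddfB fx fy subr0.
Qed.
HB.instance Definition _ := GRing.isZmodClosed.Build V ker_pred ker_pred_closed.

Definition kernel : Type := {x : V | x \in ker_pred}.
HB.instance Definition _ := SubChoice.on kernel.
HB.instance Definition _ := [SubChoice_isSubZmodule of kernel by <:].

Definition to_kernel (x : V) (fx0 : f x = 0) : kernel :=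
  exist _ x (introT eqP fx0).

Lemma kernelP (x : kernel) : f (val x) = 0.
Proof. exact/eqP/(valP x). Qed.

End Kernel.

Record cochain_complex := CochainComplex {
  cobj :> nat -> zmodType;
  cdiff : forall n, {additive cobj n -> cobj n.+1};
  cdiffK : forall n (a : cobj n), cdiff n.+1 (cdiff n a) = 0
}.

Record cochain_map (C D : cochain_complex) := CochainMap {
  cmap :> forall n, {additive C n -> D n};
  cmap_comm : forall n (a : C n), cmap n.+1 (cdiff C n a) = cdiff D n (cmap n a)
}.

Definition cocycle (C : cochain_complex) (n : nat) : zmodType :=
  kernel (cdiff C n).

Definition is_coboundary (C : cochain_complex) (n : nat) : C n -> Prop :=
  match n return C n -> Prop with
  | 0 => fun a => a = 0
  | m.+1 => fun a => exists b : C m, cdiff C m b = a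
  end.

Section CohomologyGroup.
Variables (C : cochain_complex) (n : nat).

Definition coboundary_pred : {pred cocycle C n} :=
  fun z => `[< is_coboundary (val z) >].

Fact coboundary_pred_closed : zmod_closed coboundary_pred.
Proof.
split; rewrite /coboundary_pred.
  apply/asboolP; case: n => [|m] //=.
  by exists 0; rewrite raddf0.
move=> x y /asboolP hx /asboolP hy; apply/asboolP.
case: n x y hx hy => [|m] x y /=; first by move=> -> ->; rewrite subrr.
by move=> [a ax] [b bY]; exists (a - b); rewrite raddfB ax bY.
Qed.
HB.instance Definition _ :=
  GRing.isZmodClosed.Build (cocycle C n) coboundary_pred coboundary_pred_closed.

Definition cohomology : zmodType := Quotient.quot coboundary_pred.

Definition cohomology_class (z : cocycle C n) : cohomology :=
  \pi_(Quotient.quot coboundary_pred) z.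

Fact cohomology_class_zmod_morphism : zmod_morphism cohomology_class.
Proof. by move=> x y; rewrite /cohomology_class raddfB. Qed.
HB.instance Definition _ := GRing.isZmodMorphism.Build (cocycle C n) cohomology
  cohomology_class cohomology_class_zmod_morphism.

Lemma cohomology_class_eq (x y : cocycle C n) :
  cohomology_class x = cohomology_class y <-> is_coboundary (val x - val y).
Proof.
rewrite /cohomology_class; split.
  by move/eqP; rewrite -Quotient.idealrBE => /asboolP.
by move=> h; apply/eqP; rewrite -Quotient.idealrBE; apply/asboolP.
Qed.

Definition cohomology_repr (a : cohomology) : cocycle C n :=
  repr (a : Quotient.quot coboundary_pred).

Lemma cohomology_reprK a : cohomology_class (cohomology_repr a) = a.
Proof. exact: reprK. Qed.

End CohomologyGroup.

Lemma is_coboundaryS (C : cochain_complex) (n : nat) (b : C n) :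
  is_coboundary (cdiff C n b).
Proof. by exists b. Qed.

Section CohomologyMap.
Variables (C D : cochain_complex) (f : cochain_map C D) (n : nat).

Fact cocycle_map_subproof (z : cocycle C n) : cdiff D n (f n (val z)) = 0.
Proof. by rewrite -cmap_comm kernelP raddf0. Qed.

Definition cocycle_map (z : cocycle C n) : cocycle D n :=
  to_kernel (cocycle_map_subproof z).

Definition cohomology_map (a : cohomology C n) : cohomology D n :=
  cohomology_class (cocycle_map (cohomology_repr a)).

Lemma cohomology_mapE (z : cocycle C n) :
  cohomology_map (cohomology_class z) = cohomology_class (cocycle_map z).
Proof.
apply/cohomology_class_eq => /=; rewrite -raddfB.
have /cohomology_class_eq := cohomology_reprK (cohomology_class z).
move: (val (cohomology_repr _) - _).
case: (n) => [|m] w /=; first by move=> ->; rewrite raddf0.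
by move=> [b <-]; exists (f m b); rewrite cmap_comm.
Qed.

Fact cohomology_map_zmod_morphism : zmod_morphism cohomology_map.
Proof.
move=> a b; rewrite -(cohomology_reprK a) -(cohomology_reprK b) -raddfB.
rewrite !cohomology_mapE -raddfB; congr cohomology_class.
by apply: val_inj; rewrite /= raddfB.
Qed.
HB.instance Definition _ := GRing.isZmodMorphism.Build
  (cohomology C n) (cohomology D n) cohomology_map cohomology_map_zmod_morphism.

End CohomologyMap.

Section KernelComplex.
Variables (B C : cochain_complex) (p : cochain_map B C).

Fact ker_diff_subproof n (b : kernel (p n)) : p n.+1 (cdiff B n (val b)) = 0.
Proof. by rewrite cmap_comm kernelP raddf0. Qed.

Definition ker_diff n (b : kernel (p n)) : kernel (p n.+1) :=
  to_kernel (ker_diff_subproof b).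

Fact ker_diff_zmod_morphism n : zmod_morphism (@ker_diff n).
Proof. by move=> a b; apply: val_inj; rewrite /= raddfB. Qed.
HB.instance Definition _ n := GRing.isZmodMorphism.Build
  (kernel (p n)) (kernel (p n.+1)) (@ker_diff n) (@ker_diff_zmod_morphism n).

Fact ker_diffK n (a : kernel (p n)) : ker_diff (ker_diff a) = 0.
Proof. by apply: val_inj; rewrite /= cdiffK. Qed.

Definition ker_complex : cochain_complex :=
  @CochainComplex (fun n => kernel (p n)) (fun n => @ker_diff n) ker_diffK.

Definition ker_incl_fun n : {additive ker_complex n -> B n} :=
  (val : kernel (p n) -> B n).

Fact ker_incl_comm n (a : ker_complex n) :
  ker_incl_fun n.+1 (cdiff ker_complex n a) = cdiff B n (ker_incl_fun n a).
Proof. by []. Qed.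

Definition ker_incl : cochain_map ker_complex B := CochainMap ker_incl_comm.

(* The connecting homomorphism of 0 -> ker p -> B -> C -> 0. *)
Section Connecting.
Hypothesis p_surj : forall n (c : C n), exists b : B n, p n b = c.
Variable n : nat.

Fact connecting_subproof1 (z : cocycle C n) (b : B n) :
  p n b = val z -> p n.+1 (cdiff B n b) = 0.
Proof. by move=> pb; rewrite cmap_comm pb kernelP. Qed.

Fact connecting_subproof2 (z : cocycle C n) (b : B n) (pb : p n b = val z) :
  cdiff ker_complex n.+1 (to_kernel (connecting_subproof1 pb)) = 0.
Proof. by apply: val_inj; rewrite /= cdiffK. Qed.

Definition connecting_cocycle (z : cocycle C n) (b : B n) (pb : p n b = val z) :
  cocycle ker_complex n.+1 := to_kernel (connecting_subproof2 pb).

Definition connecting (a : cohomology C n) : cohomology ker_complex n.+1 :=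
  let z := cohomology_repr a in
  cohomology_class (connecting_cocycle (projT2 (cid (p_surj (val z))))).

Lemma connectingE (z : cocycle C n) (b : B n) (pb : p n b = val z) :
  connecting (cohomology_class z) = cohomology_class (connecting_cocycle pb).
Proof.
apply/cohomology_class_eq.
set z' := cohomology_repr _; case: (cid _) => b' pb' /=.
have /cohomology_class_eq := cohomology_reprK (cohomology_class z).
rewrite -/z' -pb' -pb -raddfB => h.
suff [e [w ew]] : exists e : B n, p n e = 0 /\ cdiff B n e = cdiff B n (b' - b).
  by exists (to_kernel w); apply: val_inj; rewrite /= ew raddfB.
move: (b' - b) h; case: (n) => [|m] v /= h; first by exists v.
case: h => c dc; have [u pu] := p_surj c.
exists (v - cdiff B m u); rewrite !raddfB /= cmap_comm pu dc subrr cdiffK.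
by rewrite subr0.
Qed.

Fact connecting_zmod_morphism : zmod_morphism connecting.
Proof.
move=> a b; rewrite -(cohomology_reprK a) -(cohomology_reprK b) -raddfB.
have [u pu] := p_surj (val (cohomology_repr a)).
have [v pv] := p_surj (val (cohomology_repr b)).
have puv : p n (u - v) = val (cohomology_repr a - cohomology_repr b).
  by rewrite raddfB /= pu pv.
rewrite (connectingE pu) (connectingE pv) (connectingE puv) -raddfB.
by congr cohomology_class; do 2 apply: val_inj; rewrite /= raddfB.
Qed.
HB.instance Definition _ := GRing.isZmodMorphism.Build
  (cohomology C n) (cohomology ker_complex n.+1) connecting
  connecting_zmod_morphism.

End Connecting.
End KernelComplex.

Lemma additiveP (U V : zmodType) (f g : {additive U -> V}) : f =1 g -> f = g.
Proof.
case: f g => [f [[f1]]] [g [[g1]]] /= /funext fg.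
by subst g; rewrite (Prop_irrelevance f1 g1).
Qed.

Definition group_iso (A B : zmodType) : Prop :=
  exists f : {additive A -> B}, bijective f.

Section Presheaves.
Variables (d : Order.disp_t) (P : porderType d).

Record presheaf := Presheaf {
  psh_obj :> P -> zmodType;
  psh_res : forall x y, (x <= y)%O -> {additive psh_obj y -> psh_obj x};
  psh_res_id : forall x (xx : (x <= x)%O) a, psh_res xx a = a;
  psh_res_comp : forall x y z (xy : (x <= y)%O) (yz : (y <= z)%O)
      (xz : (x <= z)%O) a,
    psh_res xz a = psh_res xy (psh_res yz a)
}.

Record psh_hom (F G : presheaf) := PshHom {
  psh_app :> forall x, {additive F x -> G x};
  psh_nat : forall x y (xy : (x <= y)%O) a,
    psh_app x (psh_res F xy a) = psh_res G xy (psh_app y a)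
}.

Lemma psh_homP (F G : presheaf) (f g : psh_hom F G) :
  (forall x, f x =1 g x) -> f = g.
Proof.
case: f g => [f fn] [g gn] /= fg.
have e : f = g by apply: functional_extensionality_dep => x; exact/additiveP/fg.
by subst g; rewrite (Prop_irrelevance fn gn).
Qed.

Definition psh_id (F : presheaf) : psh_hom F F :=
  @PshHom F F (fun x => idfun) (fun x y xy a => erefl).

Fact psh_comp_subproof (F G K : presheaf) (g : psh_hom G K) (f : psh_hom F G)
    x y (xy : (x <= y)%O) a :
  g x (f x (psh_res F xy a)) = psh_res K xy (g y (f y a)).
Proof. by rewrite !psh_nat. Qed.

Definition psh_comp (F G K : presheaf) (g : psh_hom G K) (f : psh_hom F G) :
    psh_hom F K :=
  @PshHom F K (fun x => g x \o f x) (psh_comp_subproof g f).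

Fact psh_add_subproof (F G : presheaf) (f g : psh_hom F G)
    x y (xy : (x <= y)%O) a :
  f x (psh_res F xy a) + g x (psh_res F xy a) = psh_res G xy (f y a + g y a).
Proof. by rewrite !psh_nat raddfD. Qed.

Definition psh_add (F G : presheaf) (f g : psh_hom F G) : psh_hom F G :=
  @PshHom F G (fun x => f x \+ g x) (psh_add_subproof f g).

Record psh_functor := PshFunctor {
  fobj :> presheaf -> zmodType;
  fmap : forall F G, psh_hom F G -> {additive fobj F -> fobj G};
  fmap_id : forall F t, fmap (psh_id F) t = t;
  fmap_comp : forall F G K (g : psh_hom G K) (f : psh_hom F G) t,
    fmap (psh_comp g f) t = fmap g (fmap f t);
  fmap_add : forall F G (f g : psh_hom F G) t,
    fmap (psh_add f g) t = fmap f t + fmap g t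
}.

Definition psh_functor_iso (T T' : psh_functor) : Prop :=
  exists e : forall F, {additive T F -> T' F},
    (forall F, bijective (e F)) /\
    (forall F G (f : psh_hom F G) t, e G (fmap T f t) = fmap T' f (e F t)).

Definition injective_psh (J : presheaf) : Prop :=
  forall (A B : presheaf) (m : psh_hom A B), (forall x, injective (m x)) ->
  forall f : psh_hom A J, exists g : psh_hom B J, psh_comp g m = f.

(* 0 -> F -> I^0 -> I^1 -> ... ; exactness of presheaves is pointwise. *)
Record injective_resolution (F : presheaf) := InjectiveResolution {
  ires :> nat -> presheaf;
  ires_aug : psh_hom F (ires 0);
  ires_diff : forall n, psh_hom (ires n) (ires n.+1);
  ires_injective : forall n, injective_psh (ires n);
  ires_aug_inj : forall x, injective (ires_aug x);
  ires_exact0 : forall x (a : ires 0 x),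
    ires_diff 0 x a = 0 <-> exists b, ires_aug x b = a;
  ires_exactS : forall n x (a : ires n.+1 x),
    ires_diff n.+1 x a = 0 <-> exists b, ires_diff n x b = a
}.

Record resolution_map (F G : presheaf) (f : psh_hom F G)
    (I : injective_resolution F) (J : injective_resolution G) := ResolutionMap {
  rmap :> forall n, psh_hom (I n) (J n);
  rmap_aug : psh_comp (rmap 0) (ires_aug I) = psh_comp (ires_aug J) f;
  rmap_diff : forall n,
    psh_comp (rmap n.+1) (ires_diff I n) = psh_comp (ires_diff J n) (rmap n)
}.

Section ApplyFunctor.
Variable T : psh_functor.

Fact functor_complex_subproof F (I : injective_resolution F) n (t : T (I n)) :
  fmap T (ires_diff I n.+1) (fmap T (ires_diff I n) t) = 0.
Proof.
rewrite -fmap_comp; set h := psh_comp _ _.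
have h0 x a : h x a = 0 by apply/ires_exactS; exists a.
apply: (addrI (fmap T h t)); rewrite -fmap_add addr0.
by congr (fmap T _ t); apply: psh_homP => x a;
  transitivity (h x a + h x a); last by rewrite h0 addr0.
Qed.

Definition functor_complex F (I : injective_resolution F) : cochain_complex :=
  @CochainComplex (fun n => T (I n)) (fun n => fmap T (ires_diff I n))
    (@functor_complex_subproof F I).

Fact functor_cochain_map_subproof F G (f : psh_hom F G)
    (I : injective_resolution F) (J : injective_resolution G)
    (phi : resolution_map f I J) n (t : functor_complex I n) :
  fmap T (phi n.+1) (cdiff (functor_complex I) n t) =
  cdiff (functor_complex J) n (fmap T (phi n) t).
Proof. by rewrite /= -!fmap_comp rmap_diff. Qed.

Definition functor_cochain_map F G (f : psh_hom F G)
    (I : injective_resolution F) (J : injective_resolution G)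
    (phi : resolution_map f I J) :
    cochain_map (functor_complex I) (functor_complex J) :=
  @CochainMap (functor_complex I) (functor_complex J)
    (fun n => fmap T (phi n)) (functor_cochain_map_subproof phi).

(* R is the i-th right derived functor of T: for every injective resolution I
   of F, R F is identified with H^i(T I), compatibly with the maps induced by
   morphisms of resolutions. *)
Definition is_right_derived (i : nat) (R : psh_functor) : Prop :=
  exists e : forall F (I : injective_resolution F),
      {additive R F -> cohomology (functor_complex I) i},
    (forall F (I : injective_resolution F), bijective (e F I)) /\
    (forall F G (f : psh_hom F G) (I : injective_resolution F)
        (J : injective_resolution G) (phi : resolution_map f I J) (a : R F),
      e G J (fmap R f a) =
      cohomology_map (functor_cochain_map phi) (e F I a)).

End ApplyFunctor.

Definition lim_pred (F : presheaf) : {pred dprod F} :=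
  fun s => `[< forall x y (xy : (x <= y)%O), psh_res F xy (s y) = s x >].

Fact lim_pred_closed F : zmod_closed (@lim_pred F).
Proof.
split; first by apply/asboolP => x y xy; rewrite !dprod0E raddf0.
move=> s t /asboolP hs /asboolP ht; apply/asboolP => x y xy.
by rewrite !dprodBE raddfB hs ht.
Qed.
HB.instance Definition _ (F : presheaf) :=
  GRing.isZmodClosed.Build (dprod F) (@lim_pred F) (@lim_pred_closed F).

Definition lim_obj (F : presheaf) : Type := {s : dprod F | s \in @lim_pred F}.
HB.instance Definition _ (F : presheaf) := SubChoice.on (lim_obj F).
HB.instance Definition _ (F : presheaf) := [SubChoice_isSubZmodule of lim_obj F by <:].

Fact lim_map_subproof F G (f : psh_hom F G) (s : lim_obj F) :
  (fun x => f x (val s x)) \in @lim_pred G.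
Proof.
apply/asboolP => x y xy.
by rewrite -psh_nat; congr (f x _); move/asboolP: (valP s); apply.
Qed.

Definition lim_map F G (f : psh_hom F G) (s : lim_obj F) : lim_obj G :=
  exist (fun t : dprod G => t \in @lim_pred G) _ (lim_map_subproof f s).

Fact lim_map_zmod_morphism F G (f : psh_hom F G) : zmod_morphism (lim_map f).
Proof.
by move=> s t; apply: val_inj; apply: dprodP => x; rewrite /= !dprodBE raddfB.
Qed.
HB.instance Definition _ F G (f : psh_hom F G) := GRing.isZmodMorphism.Build
  (lim_obj F) (lim_obj G) (lim_map f) (lim_map_zmod_morphism f).

Fact lim_map_id F (s : lim_obj F) : lim_map (psh_id F) s = s.
Proof. exact: val_inj. Qed.
Fact lim_map_comp F G K (g : psh_hom G K) (f : psh_hom F G) (s : lim_obj F) :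
  lim_map (psh_comp g f) s = lim_map g (lim_map f s).
Proof. exact: val_inj. Qed.
Fact lim_map_add F G (f g : psh_hom F G) (s : lim_obj F) :
  lim_map (psh_add f g) s = lim_map f s + lim_map g s.
Proof. exact: val_inj. Qed.

Definition psh_lim : psh_functor :=
  @PshFunctor (fun F => lim_obj F) (fun F G f => lim_map f)
    lim_map_id lim_map_comp lim_map_add.

Definition is_poset_cohomology (F : presheaf) (p : nat) (H : zmodType) : Prop :=
  exists2 R : psh_functor, is_right_derived psh_lim p R & group_iso H (R F).

End Presheaves.

Definition rem_nth (T : Type) (i : nat) (s : seq T) : seq T :=
  take i s ++ drop i.+1 s.

Lemma size_rem_nth T i (s : seq T) :
  (i < size s)%N -> size (rem_nth i s) = (size s).-1.
Proof. by move=> h; rewrite size_cat size_takel ?size_drop; lia. Qed.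

Lemma rem_nth_subseq (T : eqType) i (s : seq T) : subseq (rem_nth i s) s.
Proof.
rewrite -{2}(cat_take_drop i s); apply: cat_subseq => //.
by rewrite -add1n -drop_drop; exact: drop_subseq.
Qed.

Lemma rem_nthC T i k (s : seq T) : (i <= k)%N ->
  rem_nth k (rem_nth i s) = rem_nth i (rem_nth k.+1 s).
Proof.
rewrite /rem_nth; elim: s i k => [|x s IH] [|i] [|k] //= ik; rewrite ?drop0 //.
by congr cons; exact: IH.
Qed.

Lemma alt_sum0 (M : zmodType) (g : nat -> nat -> M) m :
  (forall i k, (i <= k)%N -> (k < m)%N -> g i k = g k.+1 i) ->
  \sum_(i < m.+1) \sum_(k < m) g i k *~ ((-1) ^+ (i + k)) = 0.
Proof.
move=> gC.
under eq_bigr => i _ do rewrite (bigID (fun k : 'I_m => (i <= k)%N)) /=.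
rewrite big_split /= big_ord_recr /=.
rewrite [X in _ + X + _]big_pred0; last first.
  by move=> k; apply/negbTE; rewrite -ltnNge.
rewrite addr0 [X in _ + X](exchange_big_dep xpredT) //=.
under [X in _ + X]eq_bigr do rewrite big_mkcond big_ord_recl /= add0r -big_mkcond /=.
rewrite -big_split big1 // => i _ /=.
rewrite [X in _ + X](eq_bigl (fun k : 'I_m => (i <= k)%N)); last first.
  by move=> k; rewrite /bump /= -ltnNge.
rewrite -big_split big1 // => k ik /=.
by rewrite (gC i k) // /bump /= add1n addSn exprS mulN1r mulrNz addnC subrr.
Qed.

Section SimplicialCochains.
Variables (d : Order.disp_t) (P : porderType d).
Implicit Type Q : {pred P}.

Definition is_chain Q (n : nat) (x0 : P) (s : seq P) : bool :=
  [&& size s == n, path <=%O x0 s & all [in Q] (x0 :: s)].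

(* x_0 <= x_1 <= ... <= x_n in Q, split as x_0 and [:: x_1; ...; x_n], so that
   deleting an x_i with i > 0 preserves the first vertex definitionally. *)
Record chain Q (n : nat) := Chain {
  ch_head : P;
  ch_tail : seq P;
  ch_ok : is_chain Q n ch_head ch_tail
}.

Section Faces.
Variables (Q : {pred P}) (n : nat) (c : chain Q n.+1).

Definition ch_next : P := head (ch_head c) (ch_tail c).

Fact ch_next_le : (ch_head c <= ch_next)%O.
Proof.
by rewrite /ch_next; case: c => x0 [|x1 s] //= /and3P[_ /andP[]].
Qed.

Fact face0_subproof : is_chain Q n ch_next (behead (ch_tail c)).
Proof.
rewrite /ch_next; case: c => x0 [|x1 s] //= /and3P[sz /andP[_ hp] /andP[_ ha]].
exact/and3P.
Qed.

Definition face0 : chain Q n := Chain face0_subproof.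

Fact faceS_subproof (i : 'I_n.+1) :
  is_chain Q n (ch_head c) (rem_nth i (ch_tail c)).
Proof.
case: c => x0 s /= /and3P[/eqP sz hp ha]; apply/and3P; split.
- by rewrite size_rem_nth ?sz.
- exact: (subseq_path le_trans (rem_nth_subseq i s)).
- move: ha => /= /andP[-> /allP ha] /=; apply/allP => y ys.
  by apply: ha; exact: (mem_subseq (rem_nth_subseq i s)).
Qed.

(* omits x_(i+1) *)
Definition faceS (i : 'I_n.+1) : chain Q n := Chain (faceS_subproof i).

End Faces.

Section Complex.
Variables (Q : {pred P}) (F : presheaf P).

Definition S_cochain (n : nat) : zmodType :=
  dprod (fun c : chain Q n => F (ch_head c)).

Definition S_diff n (u : S_cochain n) : S_cochain n.+1 := fun c =>
  psh_res F (ch_next_le c) (u (face0 c)) +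
  \sum_(i < n.+1) (u (faceS c i) : F (ch_head c)) *~ ((-1) ^+ i.+1).

Fact S_diff_zmod_morphism n : zmod_morphism (@S_diff n).
Proof.
move=> u v; apply: dprodP => c; rewrite dprodBE /S_diff dprodBE raddfB.
under eq_bigr do rewrite dprodBE mulrzBl.
by rewrite sumrB opprD addrACA.
Qed.
HB.instance Definition _ n := GRing.isZmodMorphism.Build
  (S_cochain n) (S_cochain n.+1) (@S_diff n) (@S_diff_zmod_morphism n).

Lemma S_cochain_irr n (u : S_cochain n) x s (p q : is_chain Q n x s) :
  u (Chain p) = u (Chain q).
Proof. by rewrite (bool_irrelevance p q). Qed.

Lemma psh_res_irr x y (p q : (x <= y)%O) a : psh_res F p a = psh_res F q a.
Proof. by rewrite (bool_irrelevance p q). Qed.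

Definition S_ext n (u : S_cochain n) x0 (s : seq P) : F x0 :=
  if @idP (is_chain Q n x0 s) is ReflectT h then u (Chain h) else 0.

Lemma S_extE n (u : S_cochain n) x0 s (h : is_chain Q n x0 s) :
  u (Chain h) = S_ext u x0 s.
Proof.
by rewrite /S_ext; case: {-}_ / idP => [h'|//]; exact: S_cochain_irr.
Qed.

Lemma S_ext_diff n (u : S_cochain n) x0 x1 s (x01 : (x0 <= x1)%O) :
  is_chain Q n.+1 x0 (x1 :: s) ->
  S_ext (S_diff u) x0 (x1 :: s) = psh_res F x01 (S_ext u x1 s) +
    \sum_(i < n.+1) S_ext u x0 (rem_nth i (x1 :: s)) *~ ((-1) ^+ i.+1).
Proof.
move=> ok; rewrite -(S_extE _ ok) /S_diff; congr (_ + _).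
  rewrite (psh_res_irr _ x01); congr (psh_res F x01 _).
  exact: (S_extE u (face0_subproof (Chain ok))).
apply: eq_bigr => i _; congr (_ *~ _).
exact: (S_extE u (faceS_subproof (Chain ok) i)).
Qed.

Fact S_diffK n (u : S_cochain n) : S_diff (S_diff u) = 0.
Proof.
apply: dprodP => -[x0 [|x1 [|x2 s]] ok].
- by case/and3P: (ok) => /eqP.
- by case/and3P: (ok) => /eqP.
have okS i : (i < n.+2)%N -> is_chain Q n.+1 x0 (rem_nth i [:: x1, x2 & s]).
  by move=> hi; exact: (faceS_subproof (Chain ok) (Ordinal hi)).
have ok0 : is_chain Q n.+1 x1 (x2 :: s) := face0_subproof (Chain ok).
have /and3P[_ /= /and3P[x01 x12 _] _] := ok.
have x02 := le_trans x01 x12.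
rewrite dprod0E S_extE (S_ext_diff _ x01 ok) (S_ext_diff _ x12 ok0) raddfD.
rewrite -(psh_res_comp x01 x12 x02) [X in _ + X = _]big_ord_recl /=.
have -> : rem_nth 0 [:: x1, x2 & s] = x2 :: s by [].
rewrite (S_ext_diff _ x02); last exact: (okS 0%N isT).
pose D i k := S_ext u x0 (rem_nth k (rem_nth i [:: x1, x2 & s])).
have DC i k : (i <= k)%N -> (k < n.+1)%N -> D i k = D k.+1 i.
  by move=> ik _; rewrite /D rem_nthC.
have := alt_sum0 DC; rewrite big_ord_recl /= => /eqP.
rewrite addr_eq0 => /eqP sumD.
have -> : \sum_(i < n.+1) S_ext u x0 (rem_nth i (x2 :: s)) *~ (-1) ^+ i.+1 =
    \sum_(i < n.+1) \sum_(k < n.+1) D i.+1 k *~ (-1) ^+ (i.+1 + k).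
  rewrite -[RHS]opprK -sumD -sumrN; apply: eq_bigr => i _.
  by rewrite exprS mulN1r mulrNz.
under [X in _ + (_ + X)]eq_bigr => i _.
  have -> : rem_nth (bump 0 i) [:: x1, x2 & s] = x1 :: rem_nth i (x2 :: s) by [].
  rewrite (S_ext_diff _ x01); last by exact: (okS i.+1 (ltn_ord i)).
  rewrite mulrzDl /bump /= add1n.
  over.
rewrite big_split /= expr1 mulrN1z raddf_sum.
set A := psh_res _ _ _.
have -> : \sum_(i < n.+1) psh_res F x01
      (S_ext u x1 (rem_nth i (x2 :: s)) *~ (-1) ^+ i.+1) =
    - \sum_(i < n.+1) psh_res F x01 (S_ext u x1 (rem_nth i (x2 :: s))) *~
      (-1) ^+ i.+2.
  by rewrite -sumrN; apply: eq_bigr => i _; rewrite raddfMz [in RHS]exprSr mulrN1 mulrNz opprK.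
set B := \sum_(i < n.+1) _; set E := \sum_(i < n.+1) \sum_(k < n.+1) _.
suff -> : \sum_(i < n.+1) (\sum_(k < n.+1) S_ext u x0
    (rem_nth k (x1 :: rem_nth i (x2 :: s))) *~ (-1) ^+ k.+1) *~ (-1) ^+ i.+2 = E.
  by rewrite opprD addrACA addNKr addKr addNr.
apply: eq_bigr => i _; rewrite mulrz_suml; apply: eq_bigr => k _.
rewrite -mulrzA -exprD; congr (_ *~ _).
by rewrite !addSn !addnS exprS exprS !mulN1r opprK addnC.
Qed.

Definition S_complex : cochain_complex :=
  @CochainComplex S_cochain (fun n => @S_diff n) S_diffK.

End Complex.

(* Presheaves on subposets of P are restrictions of presheaves on P, so the
   restriction is left implicit: S_complex Q F stands for S^*(Q, F|_Q). *)
Section Pair.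
Variables (Q Q' : {pred P}) (Q'Q : {subset Q' <= Q}) (F : presheaf P).

Fact chain_incl_subproof n (c : chain Q' n) : is_chain Q n (ch_head c) (ch_tail c).
Proof.
case: c => x0 s /= /and3P[sz hp /allP ha]; apply/and3P; split => //.
by apply/allP => y ys; exact/Q'Q/ha.
Qed.

Definition chain_incl n (c : chain Q' n) : chain Q n :=
  Chain (chain_incl_subproof c).

Definition S_res_fun n (u : S_cochain Q F n) : S_cochain Q' F n :=
  fun c => u (chain_incl c).

Fact S_res_zmod_morphism n : zmod_morphism (@S_res_fun n).
Proof. by []. Qed.
HB.instance Definition _ n := GRing.isZmodMorphism.Build
  (S_cochain Q F n) (S_cochain Q' F n) (@S_res_fun n) (@S_res_zmod_morphism n).

Fact S_res_comm n (u : S_cochain Q F n) :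
  S_res_fun (S_diff u) = S_diff (S_res_fun u).
Proof.
apply: dprodP => c; rewrite /S_res_fun /S_diff; congr (_ + _).
  rewrite (psh_res_irr _ (ch_next_le c)); congr (psh_res F _ _).
  exact: S_cochain_irr.
by apply: eq_bigr => i _; congr (_ *~ _); exact: S_cochain_irr.
Qed.

Definition S_res : cochain_map (S_complex Q F) (S_complex Q' F) :=
  @CochainMap (S_complex Q F) (S_complex Q' F) (fun n => @S_res_fun n) S_res_comm.

Lemma S_res_surj n (v : S_complex Q' F n) :
  exists u : S_complex Q F n, S_res n u = v.
Proof.
exists (fun c => S_ext v (ch_head c) (ch_tail c)).
by apply: dprodP => -[x0 s ok]; rewrite /= /S_res_fun /= -S_extE.
Qed.

Definition HS (n : nat) : zmodType := cohomology (S_complex Q F) n.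

Definition HS_rel (n : nat) : zmodType := cohomology (ker_complex S_res) n.

Definition HS_rel_incl (n : nat) : {additive HS_rel n -> HS n} :=
  @cohomology_map _ _ (ker_incl S_res) n.

Definition HS_connecting (n : nat) :
    {additive cohomology (S_complex Q' F) n -> HS_rel n.+1} :=
  @connecting _ _ S_res S_res_surj n.

End Pair.

Definition covers (x z : P) : Prop :=
  (x < z)%O /\ forall y, (x <= y)%O -> (y <= z)%O -> y = x \/ y = z.

Definition is_rank_function (rk : P -> int) : Prop :=
  (forall x y, (x < y)%O -> rk x < rk y) /\
  (forall x y, covers x y -> rk y = rk x + 1).

Definition bounded_above (rk : P -> int) : Prop := exists m, forall x, rk x <= m.

Definition is_corank_function (rk crk : P -> int) : Prop :=
  exists r, [/\ exists x, rk x = r, forall x, rk x <= r &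
                forall x, crk x = r - rk x].

Section CellularCohomology.
Variables (crk : P -> int) (F : presheaf P).

Definition skeleton (k : nat) : {pred P} := [pred x | crk x <= k%:Z].

(* P^(n-1), with P^(-1) empty *)
Definition prev_skeleton (n : nat) : {pred P} :=
  if n is m.+1 then skeleton m else pred0.

Fact prev_skeleton_sub n : {subset prev_skeleton n <= skeleton n}.
Proof.
by case: n => [|m] x //; rewrite !inE => /le_trans; apply; rewrite lez_nat.
Qed.

Definition cell_group (n : nat) : zmodType := HS_rel (@prev_skeleton_sub n) F n.

Definition cell_diff (n : nat) : {additive cell_group n -> cell_group n.+1} :=
  HS_connecting (@prev_skeleton_sub n.+1) F n \o
  HS_rel_incl (@prev_skeleton_sub n) F n.

End CellularCohomology.
End SimplicialCochains.

Definition is_graded (d : Order.disp_t) (P : porderType d) : Prop :=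
  exists rk : P -> int, is_rank_function rk.

(* A is an arbitrary type of algebraic structures. *)
Record structured_space (X : topologicalType) (A : Type) := StructuredSpace {
  sdom : set (set X);
  smap : {U : set X | sdom U} -> A;
  sdom_cover : forall x, exists2 U, sdom U & U x;
  sdom_nbhs : forall U, sdom U -> exists x : X, nbhs x U
}.

Section AssociatedPoset.
Variables (X : topologicalType) (A : Type) (S : structured_space X A).

Definition hmap (x : X) : set (set X) := [set U | sdom S U /\ U x].

Definition hmap_equiv : rel X := fun x y => `[< hmap x = hmap y >].

Fact hmap_equiv_class : equiv_class_of hmap_equiv.
Proof.
split=> [x|x y|y x z]; first exact/asboolP.
  by apply/asboolP/asboolP.
by move=> /asboolP xy /asboolP yz; apply/asboolP; rewrite xy.
Qed.
Canonical hmap_equiv_rel := EquivRelPack hmap_equiv_class.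

Definition assoc_poset : Type := {eq_quot hmap_equiv}.
HB.instance Definition _ := EqQuotient.on assoc_poset.
HB.instance Definition _ := Choice.on assoc_poset.

Definition assoc_class (x : X) : assoc_poset := \pi_assoc_poset x.

Definition hquot (p : assoc_poset) : set (set X) := hmap (repr p).

Lemma hquotE x : hquot (assoc_class x) = hmap x.
Proof.
by apply/asboolP/(@eqmodP _ hmap_equiv_rel); rewrite reprK.
Qed.

Definition assoc_le (p q : assoc_poset) : bool := `[< hquot p `<=` hquot q >].

Fact assoc_le_refl : reflexive assoc_le.
Proof. by move=> p; apply/asboolP. Qed.
Fact assoc_le_anti : antisymmetric assoc_le.
Proof.
move=> p q /andP[/asboolP pq /asboolP qp].
rewrite -[p]reprK -[q]reprK; apply/eqmodP/asboolP.
exact/seteqP.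
Qed.
Fact assoc_le_trans : transitive assoc_le.
Proof.
move=> q p r /asboolP pq /asboolP qr; apply/asboolP.
exact: (subset_trans pq qr).
Qed.

Fact assoc_display : Order.disp_t. Proof. exact: (Order.Disp tt tt). Qed.
HB.instance Definition _ := Order.Le_isPOrder.Build assoc_display assoc_poset
  assoc_le_refl assoc_le_anti assoc_le_trans.

Lemma assoc_leE (x y : X) :
  (assoc_class x <= assoc_class y)%O = `[< hmap x `<=` hmap y >].
Proof. by rewrite -(hquotE x) -(hquotE y). Qed.

Definition nonempty_subcollections : set (set (set X)) :=
  [set V | V `<=` sdom S /\ V !=set0].

Definition card_rank (p : assoc_poset) : int := #|` fset_set (hquot p)|%:Z.

End AssociatedPoset.

(* Main.v *)
(** An abelian group homomorphism from a subgroup to a divisible group extends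
    to the whole group (Zorn), so Q/Z is injective and separates any element
    from any subgroup not containing it.  Products over y <= x of groups D y,
    with projections as restrictions, are injective presheaves when the D y are;
    taking for D y a product of copies of Q/Z indexed by the homomorphisms
    G y -> Q/Z that vanish on K y gives, for each subpresheaf K of G, a map from
    G to an injective presheaf with kernel exactly K.  Iterating with K the
    image of the previous map yields injective resolutions, without cokernels.
    Maps between resolutions exist and are unique up to homotopy, hence the
    derived functors exist and are unique.

    For the rank function, surjectivity of h realises h(p) plus one extra
    collection as some h(x), so that a cover adds exactly one collection.  The
    cellular differential squares to zero because it contains two consecutive
    maps of the long exact sequence of a pair. *)

Require Import Defs.
From HB Require Import structures.
From mathcomp Require Import all_boot all_order all_algebra.
From mathcomp Require Import boolp classical_sets functions cardinality topology.
From mathcomp Require Import finmap.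

Set Implicit Arguments.
Unset Strict Implicit.
Unset Printing Implicit Defensive.

Import Order.TTheory GRing.Theory Num.Theory.
Local Open Scope classical_set_scope.
Local Open Scope quotient_scope.
Local Open Scope ring_scope.

(** * Divisible and injective abelian groups *)

(** Packs additive maps that are constructed inside proofs, where no instance can be declared. *)
Definition mk_additive (U V : zmodType) (f : U -> V) (fB : zmod_morphism f) :
  {additive U -> V} := HB.pack f (GRing.isZmodMorphism.Build U V f fB).

Definition is_subgroup (V : zmodType) (H : set V) : Prop :=
  H 0 /\ forall x y, H x -> H y -> H (x - y).

Section Subgroups.
Variables (V : zmodType) (H : set V).
Hypothesis subH : is_subgroup H.

Lemma subgroupN x : H x -> H (- x).
Proof. by case: subH => H0 HB Hx; rewrite -sub0r; exact: HB. Qed.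

Lemma subgroupD x y : H x -> H y -> H (x + y).
Proof.
by case: subH => _ HB Hx Hy; rewrite -(opprK y); apply: HB => //; exact: subgroupN.
Qed.

Lemma subgroupMz x (n : int) : H x -> H (x *~ n).
Proof.
have natH (m : nat) y : H y -> H (y *+ m).
  move=> Hy; elim: m => [|m IH]; first by case: subH; rewrite mulr0n.
  by rewrite mulrS; exact: subgroupD.
move=> Hx; case: n => n; first exact: natH.
by rewrite NegzE mulrNz; apply: subgroupN; exact: natH.
Qed.

(** The integers n with n x in [H] form an ideal of Z, hence a principal one; the generator m = 0
    means that no nonzero multiple of x lies in [H]. *)
Lemma subgroup_annihilator x :
  exists m : nat, forall n : int, H (x *~ n) <-> (m %| n)%Z.
Proof.
have [ex|nex] := pselect (exists m : nat, (0 < m)%N && `[< H (x *+ m) >]).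
  case: (ex_minnP ex) => m /andP[m_gt0 /asboolP Hm] minm.
  exists m => n; split=> [Hn|/dvdzP[q ->]]; last first.
    by rewrite mulrC mulrzA; exact: subgroupMz.
  (* The remainder of n modulo the least positive m also sends x into [H], so minimality makes it
     zero. *)
  have Hr : H (x *~ (n %% m)%Z).
    have -> : (n %% m)%Z = n - (n %/ m)%Z * m%:Z.
      by rewrite {2}(divz_eq n m) addrC addKr.
    rewrite mulrzBr; case: subH => _; apply; first exact: Hn.
    by rewrite mulrC mulrzA; exact: subgroupMz.
  have r_ge0 : 0 <= (n %% m)%Z by rewrite modz_ge0 // eqz_nat -lt0n.
  have r_lt : (n %% m)%Z < m by rewrite ltz_pmod.
  apply/dvdz_mod0P; move: Hr r_ge0 r_lt; case: (n %% m)%Z => // -[//|r] Hr _.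
  rewrite ltz_nat => rm; suff /minm : (0 < r.+1)%N && `[< H (x *+ r.+1) >].
    by rewrite leqNgt rm.
  exact/asboolP.
exists 0%N => n; rewrite dvd0z; split=> [Hn|/eqP->]; last first.
  by rewrite mulr0z; case: subH.
apply/negPn/negP => n0; apply: nex; exists `|n|%N; rewrite absz_gt0 n0.
apply/asboolP; case: n Hn {n0} => n //=.
by rewrite NegzE mulrNz => /subgroupN; rewrite opprK.
Qed.

End Subgroups.

Definition divisible (D : zmodType) : Prop :=
  forall (n : nat) (a : D), (0 < n)%N -> exists b, b *+ n = a.

(* Graphs of homomorphisms defined on a subgroup of B. *)
Definition partial_hom (B D : zmodType) (G : set (B * D)%type) : Prop :=
  is_subgroup G /\ forall a, G (0, a) -> a = 0.

Section DivisibleExtension.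
Variables (B D : zmodType).
Hypothesis divD : divisible D.

(** With m generating the annihilator of b modulo the domain and a0 the value at m b, divisibility
    gives e with m e = a0, and b is sent to e. *)
Lemma partial_hom_extend1 (G : set (B * D)%type) (b : B) : partial_hom G ->
  exists G' : set (B * D)%type,
    [/\ partial_hom G', G `<=` G' & exists a, G' (b, a)].
Proof.
move=> [subG funG]; have [G0 GB] := subG.
pose dom : set B := [set x | exists a, G (x, a)].
have subdom : is_subgroup dom.
  split=> [|x y [a Ga] [c Gc]]; first by exists 0.
  by exists (a - c); exact: (GB _ _ Ga Gc).
have [m mP] := subgroup_annihilator subdom b.
have [a0 Ga0] : dom (b *~ m) by apply/mP; exact: dvdzz.
have [e em] : exists e : D, e *+ m = a0.
  (* For m = 0 the value a0 is forced to be 0, and any e would do. *)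
  case: (posnP m) => [m0|]; last exact: divD.
  exists 0; rewrite mul0rn; apply/esym/funG.
  by move: Ga0; rewrite m0 mulr0z.
pose step (n : int) : (B * D)%type := (b *~ n, e *~ n).
have stepB n k : step (n - k) = step n - step k.
  by rewrite /step !mulrzBr.
exists [set v | exists n u, G u /\ v = u + step n]; split.
- split; first split.
  + by exists 0, 0; rewrite add0r /step !mulr0z.
  + move=> _ _ [n [u [Gu ->]]] [k [v [Gv ->]]].
    exists (n - k), (u - v); split; first exact: GB.
    by rewrite stepB opprD addrACA.
  (* If u + n (b, e) = (0, a) with u in [G], then n b lies in the domain, so n = q m and n e = q a0:
     the pair (0, a) is already in [G]. *)
  + move=> a [n [[x c] [Gu [xb ->]]]].
    have bnx : b *~ n = - x by apply/eqP; rewrite -addr_eq0 addrC -xb.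
    have /dvdzP[q nq] : (m %| n)%Z.
      by apply/mP; exists (- c); rewrite bnx; exact: (subgroupN subG Gu).
    have Gq := subgroupD subG Gu (subgroupMz subG q Ga0).
    apply: funG; rewrite nq mulrC mulrzA -pmulrn em.
    suff <- : (x, c) + (b *~ m, a0) *~ q = (0, c + a0 *~ q) by [].
    rewrite [LHS]surjective_pairing /= !raddfMz /= -mulrzA mulrC -nq.
    by rewrite -xb.
- by move=> u Gu; exists 0, u; rewrite /step !mulr0z addr0.
- by exists e, 1, 0; rewrite add0r /step !mulr1z.
Qed.

Lemma divisible_extend (G : set (B * D)%type) : partial_hom G ->
  exists h : {additive B -> D}, forall x a, G (x, a) -> h x = a.
Proof.
move=> homG.
(* The chain condition also covers the empty chain, whose union is empty; joining [G] to every
   member makes this case hold. *)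
have [F Fsub Ftot|M [homM maxM]] :=
    @Zorn_bigcup _ [set M : set (B * D)%type | partial_hom (M `|` G)].
  set N := \bigcup_(M in F) M.
  have inN u v : (N `|` G) u -> (N `|` G) v ->
      exists M, [/\ partial_hom M, M `<=` N `|` G, M u & M v].
    have GN : G `<=` N `|` G by move=> w; right.
    have MN M : F M -> M `|` G `<=` N `|` G.
      by move=> FM w [Mw|]; [left; exists M|right].
    move=> [[M FM Mu]|Gu] [[M' FM' Mv]|Gv].
    - case: (Ftot _ _ FM FM') => MM'.
        by exists (M' `|` G); split;
          [exact: Fsub|exact: MN|left; exact: MM'|left].
      by exists (M `|` G); split; [exact: Fsub|exact: MN|left|left; exact: MM'].
    - by exists (M `|` G); split; [exact: Fsub|exact: MN|left|right].
    - by exists (M' `|` G); split; [exact: Fsub|exact: MN|right|left].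
    - by exists G.
  split; first split.
  - by right; case: homG => -[].
  - move=> u v Nu Nv; have [M [[[_ MB] _] MN Mu Mv]] := inN _ _ Nu Nv.
    exact/MN/MB.
  - move=> a Na; have [M [[_ funM] _ Ma _]] := inN _ _ Na Na.
    exact: funM.
(* A maximal graph is defined everywhere, since otherwise it could be extended to one more
   element. *)
have tot b : exists a, (M `|` G) (b, a).
  have [M' [homM' MM' [a M'a]]] := partial_hom_extend1 b homM.
  have [M'M|/nonsubset[v [M'v nMv]]] := pselect (M' `<=` M `|` G).
    by exists a; exact: M'M.
  case: (maxM M').
    split=> [u Mu|M'M]; first by apply: MM'; left.
    by apply: nMv; left; exact: M'M.
  suff -> : [set M | partial_hom (M `|` G)] M' = partial_hom M' by [].
  by rewrite /= (setUidl (subset_trans _ MM')) // => u; right.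
have [[_ MB] funM] := homM.
have fun2 x a c : (M `|` G) (x, a) -> (M `|` G) (x, c) -> a = c.
  move=> Ma Mc; apply/eqP; rewrite -subr_eq0; apply/eqP/funM.
  by rewrite -(subrr x); exact: (MB _ _ Ma Mc).
pose f b := projT1 (cid (tot b)).
have Mf b : (M `|` G) (b, f b) by exact: (projT2 (cid (tot b))).
have fB : zmod_morphism f.
  by move=> x y; apply: (fun2 (x - y)); [exact: Mf|exact: (MB _ _ (Mf x) (Mf y))].
by exists (mk_additive fB) => x a Ga; apply: (fun2 x); [exact: Mf|right].
Qed.

End DivisibleExtension.

(** * The group Q/Z and injectivity of divisible groups *)

Definition int_pred : {pred rat} := fun q => q \is a Num.int.

Fact int_pred_closed : zmod_closed int_pred.
Proof. by split=> [|x y]; [exact: rpred0|exact: rpredB]. Qed.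
HB.instance Definition _ :=
  GRing.isZmodClosed.Build rat int_pred int_pred_closed.

Definition rat_mod_int : zmodType := Quotient.quot int_pred.

Definition rat_class (q : rat) : rat_mod_int := \pi_(Quotient.quot int_pred) q.

Fact rat_class_zmod_morphism : zmod_morphism rat_class.
Proof. by move=> x y; rewrite /rat_class raddfB. Qed.
HB.instance Definition _ := GRing.isZmodMorphism.Build rat rat_mod_int
  rat_class rat_class_zmod_morphism.

Lemma rat_class_eq0 q : rat_class q = 0 <-> q \is a Num.int.
Proof.
rewrite -(raddf0 rat_class) /rat_class; split=> [/eqP|qZ].
  by rewrite -Quotient.idealrBE subr0.
by apply/eqP; rewrite -Quotient.idealrBE subr0.
Qed.

Lemma rat_mod_int_divisible : divisible rat_mod_int.
Proof.
move=> n a n_gt0; exists (rat_class (repr (a : Quotient.quot int_pred) / n%:R)).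
rewrite -raddfMn -[_ / _ *+ _]mulr_natr divfK ?pnatr_eq0 -?lt0n //.
exact: reprK.
Qed.

(** Sending [H] to 0 and b to a nonzero q is well defined on [H] + Z b once the annihilator m of b
    modulo [H] kills q; divisibility then extends this map to all of [V]. *)
Lemma rat_mod_int_separates (V : zmodType) (H : set V) (b : V) :
  is_subgroup H -> ~ H b ->
  exists phi : {additive V -> rat_mod_int},
    (forall x, H x -> phi x = 0) /\ phi b <> 0.
Proof.
move=> subH nHb; have [m mP] := subgroup_annihilator subH b.
have m_neq1 : m != 1%N.
  by apply/eqP => m1; apply: nHb; apply/(mP 1); rewrite m1 dvd1z.
(* The class of 1/m serves, or of 1/2 when m = 0; m = 1 is excluded because b is not in [H]. *)
have [q q_neq0 qm] : exists2 q : rat_mod_int, q <> 0 & q *+ m = 0.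
  have unit_frac (k : nat) : (1 < k)%N ->
      rat_class (k%:R^-1) <> 0 /\ rat_class (k%:R^-1) *+ k = 0.
    move=> k1; have k0 : (0 < k)%N by exact: ltnW.
    split; last first.
      by rewrite -raddfMn -[_^-1 *+ _]mulr_natr mulVf ?pnatr_eq0 -?lt0n //; apply/rat_class_eq0.
    (* A nonzero integer has absolute value at least 1, whereas 1/k < 1. *)
    move/rat_class_eq0 => /norm_intr_ge1 /(_ _).
    rewrite invr_eq0 pnatr_eq0 -lt0n k0 => /(_ isT).
    rewrite ger0_norm ?invr_ge0 ?ler0n // leNgt invf_lt1 ?ltr0n //.
    by rewrite ltr1n k1.
  case: m m_neq1 {mP} => [|[|m]] // _.
    by exists (rat_class 2%:R^-1); [case: (unit_frac 2%N)|rewrite mulr0n].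
  by exists (rat_class m.+2%:R^-1); case: (unit_frac m.+2).
pose G : set (V * rat_mod_int)%type :=
  [set v | exists (n : int) h, H h /\ v = (h + b *~ n, q *~ n)].
have [H0 HB] := subH.
have homG : partial_hom G.
  split; first split.
  - by exists 0, 0; rewrite !mulr0z addr0.
  - move=> _ _ [n [u [Hu ->]]] [k [v [Hv ->]]].
    exists (n - k), (u - v); split; first exact: HB.
    by rewrite !mulrzBr addrACA -opprD.
  - move=> a [n [h [Hh [hb ->]]]].
    have /mP/dvdzP[l ->] : H (b *~ n).
      have -> : b *~ n = - h by apply/eqP; rewrite -addr_eq0 addrC -hb.
      exact: subgroupN.
    by rewrite mulrC mulrzA -pmulrn qm mul0rz.
have [phi phiP] := divisible_extend rat_mod_int_divisible homG.
exists phi; split=> [x Hx|].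
  by apply: phiP; exists 0, x; rewrite !mulr0z addr0.
by rewrite (phiP b q) //; exists 1, 0; rewrite add0r !mulr1z.
Qed.

Definition injective_group (D : zmodType) : Prop :=
  forall (A B : zmodType) (m : {additive A -> B}), injective m ->
  forall f : {additive A -> D}, exists g : {additive B -> D},
    forall a, g (m a) = f a.

(** Injectivity of [m] makes the pairs (m a, f a) the graph of a homomorphism defined on the image
    of [m]. *)
Lemma divisible_injective (D : zmodType) : divisible D -> injective_group D.
Proof.
move=> divD A B m m_inj f.
have [|g gP] := @divisible_extend B D divD [set v | exists a, v = (m a, f a)].
  split; first split.
  - by exists 0; rewrite !raddf0.
  - by move=> _ _ [a ->] [c ->]; exists (a - c); rewrite !raddfB.
  - by move=> d [a [/esym/eqP]]; rewrite raddf_eq0 // => /eqP-> ->; rewrite raddf0.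
by exists g => a; apply: gP; exists a.
Qed.

Lemma dprod_injective (I : Type) (D : I -> zmodType) :
  (forall i, injective_group (D i)) -> injective_group (dprod D).
Proof.
move=> injD A B m m_inj f.
have fiB i : zmod_morphism (fun a => f a i) by move=> a b; rewrite raddfB.
have ex i := cid (injD i A B m m_inj (mk_additive (fiB i))).
have gB : zmod_morphism (fun b => (fun i => projT1 (ex i) b) : dprod D).
  by move=> a b; apply: dprodP => i; rewrite dprodBE raddfB.
by exists (mk_additive gB) => a; apply: dprodP => i; exact: (projT2 (ex i) a).
Qed.

(** * Injective resolutions of presheaves *)

Section EnoughInjectives.
Variables (d : Order.disp_t) (P : porderType d).

Section Coinduced.
Variable D : P -> zmodType.

Definition coind_obj (x : P) : zmodType :=
  dprod (fun y : {y : P | (y <= x)%O} => D (sval y)).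

Definition coind_res_fun x y (xy : (x <= y)%O) (u : coind_obj y) : coind_obj x :=
  fun z => u (exist _ (sval z) (le_trans (svalP z) xy)).

Fact coind_res_zmod_morphism x y (xy : (x <= y)%O) :
  zmod_morphism (coind_res_fun xy).
Proof. by []. Qed.
HB.instance Definition _ x y (xy : (x <= y)%O) := GRing.isZmodMorphism.Build
  (coind_obj y) (coind_obj x) (coind_res_fun xy) (coind_res_zmod_morphism xy).

Lemma coind_irr x (u : coind_obj x) y (p q : (y <= x)%O) :
  u (exist _ y p) = u (exist _ y q).
Proof. by rewrite (bool_irrelevance p q). Qed.

Fact coind_res_id x (xx : (x <= x)%O) u : coind_res_fun xx u = u.
Proof.
apply: dprodP => -[z zx].
exact: (coind_irr u (le_trans (svalP (exist _ z zx)) xx)).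
Qed.

Fact coind_res_comp x y z (xy : (x <= y)%O) (yz : (y <= z)%O)
    (xz : (x <= z)%O) u :
  coind_res_fun xz u = coind_res_fun xy (coind_res_fun yz u).
Proof.
by apply: dprodP => w; exact: (coind_irr u (le_trans (svalP w) xz)).
Qed.

(* The product over y of the right adjoints of evaluation at y, applied to D y. *)
Definition coind : presheaf P :=
  @Presheaf _ P coind_obj (fun x y xy => coind_res_fun xy)
    coind_res_id coind_res_comp.

Section Lift.
Variables (B : presheaf P) (h : forall y, {additive B y -> D y}).

Definition coind_lift_fun x (b : B x) : coind x :=
  fun z => h (sval z) (psh_res B (svalP z) b).

Fact coind_lift_zmod_morphism x : zmod_morphism (@coind_lift_fun x).
Proof.
by move=> a b; apply: dprodP => z; rewrite dprodBE /coind_lift_fun !raddfB.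
Qed.
HB.instance Definition _ x := GRing.isZmodMorphism.Build
  (B x) (coind x) (@coind_lift_fun x) (@coind_lift_zmod_morphism x).

Fact coind_lift_nat x y (xy : (x <= y)%O) a :
  coind_lift_fun (psh_res B xy a) = psh_res coind xy (coind_lift_fun a).
Proof.
apply: dprodP => z; rewrite /coind_lift_fun /= /coind_res_fun /=.
rewrite -(psh_res_comp (svalP z) xy (le_trans (svalP z) xy)).
by congr (h _ _); exact: psh_res_irr.
Qed.

(** The morphism that corresponds to the family [h] under the adjunction between evaluation and
    coinduction. *)
Definition coind_lift : psh_hom B coind :=
  @PshHom _ P B coind (fun x => @coind_lift_fun x) coind_lift_nat.

End Lift.

(** By naturality a morphism into [coind D] is determined by its coordinates at the indices y <= y;
    these extend along [m] one group at a time. *)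
Lemma coind_injective : (forall y, injective_group (D y)) -> injective_psh coind.
Proof.
move=> injD A B m m_inj f.
have fyB y : zmod_morphism (fun a : A y => f y a (exist _ y (lexx y))).
  by move=> a b; rewrite raddfB.
have ex y := cid (injD y _ _ (m y) (m_inj y) (mk_additive (fyB y))).
exists (coind_lift (fun y => projT1 (ex y))); apply: psh_homP => x a.
apply: dprodP => -[z zx] /=; rewrite /coind_lift_fun /= -psh_nat.
rewrite (projT2 (ex z)) /= psh_nat /= /coind_res_fun /=.
exact: (coind_irr (f x a)
  (le_trans (svalP (exist _ z (lexx z))) (svalP (exist _ z zx)))).
Qed.

End Coinduced.

Section InjectiveEnvelope.
Variables (G : presheaf P) (K : forall x, set (G x)).

Definition env_factor (x : P) : zmodType :=
  dprod (fun _ : {phi : {additive G x -> rat_mod_int} |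
                   forall a, K a -> phi a = 0} => rat_mod_int).

Definition env : presheaf P := coind env_factor.

Definition env_eval x (a : G x) : env_factor x := fun phi => sval phi a.

Fact env_eval_zmod_morphism x : zmod_morphism (@env_eval x).
Proof. by move=> a b; apply: dprodP => i; rewrite dprodBE /env_eval raddfB. Qed.
HB.instance Definition _ x := GRing.isZmodMorphism.Build
  (G x) (env_factor x) (@env_eval x) (@env_eval_zmod_morphism x).

Definition env_hom : psh_hom G env := coind_lift (fun x => @env_eval x).

Lemma env_injective : injective_psh env.
Proof.
apply: coind_injective => y; apply: dprod_injective => _.
exact/divisible_injective/rat_mod_int_divisible.
Qed.

(** An element outside [K] is detected at the index x <= x by a homomorphism to Q/Z that kills [K];
    conversely, stability under restriction makes every coordinate vanish on [K]. *)
Lemma env_hom_eq0 : (forall x, is_subgroup (@K x)) ->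
  (forall x y (xy : (x <= y)%O) a, K a -> K (psh_res G xy a)) ->
  forall x (a : G x), env_hom x a = 0 <-> K a.
Proof.
move=> subK resK x a; split=> [a0|Ka]; last first.
  by apply: dprodP => -[y yx]; apply: dprodP => -[phi phiK]; exact/phiK/resK.
apply: contrapT => nKa.
have [phi [phiK]] := rat_mod_int_separates (subK x) nKa; apply.
pose i := exist (fun phi : {additive G x -> rat_mod_int} =>
  forall a, K a -> phi a = 0) phi phiK.
have : env_hom x a (exist _ x (lexx x)) i = 0 by rewrite a0.
by rewrite /= /coind_lift_fun /= psh_res_id.
Qed.

End InjectiveEnvelope.

(** Bundling both ends with the morphism lets a resolution be built by [iter], each arrow being
    determined by the whole previous one. *)
Definition psh_arrow := {G : presheaf P & {J : presheaf P & psh_hom G J}}.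

Definition arrow_src (s : psh_arrow) : presheaf P := projT1 s.
Definition arrow_tgt (s : psh_arrow) : presheaf P := projT1 (projT2 s).
Definition arrow_hom (s : psh_arrow) : psh_hom (arrow_src s) (arrow_tgt s) :=
  projT2 (projT2 s).

Definition arrow_image (s : psh_arrow) x : set (arrow_tgt s x) :=
  [set a | exists b, arrow_hom s x b = a].

Definition env_arrow (G : presheaf P) (K : forall x, set (G x)) : psh_arrow :=
  existT _ G (existT _ (env K) (env_hom K)).

Definition next_arrow (s : psh_arrow) : psh_arrow := env_arrow (@arrow_image s).

Section Resolution.
Variable F : presheaf P.

(** Arrow 0 is the augmentation and arrow n + 1 is the differential from degree n to degree n + 1;
    consecutive arrows are composable by computation. *)
Definition res_arrow (n : nat) : psh_arrow :=
  iter n next_arrow (env_arrow (fun x => [set 0 : F x])).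

Definition res_obj (n : nat) : presheaf P := arrow_tgt (res_arrow n).

Definition res_diff (n : nat) : psh_hom (res_obj n) (res_obj n.+1) :=
  arrow_hom (res_arrow n.+1).

Fact res_injective n : injective_psh (res_obj n).
Proof. by case: n => [|n]; exact: env_injective. Qed.

Lemma env_hom0_eq0 x (a : F x) :
  env_hom (fun x => [set 0 : F x]) x a = 0 <-> a = 0.
Proof.
apply: env_hom_eq0 => [y|y z yz b ->]; last exact: raddf0.
by split=> // b c -> ->; rewrite subr0.
Qed.

Fact res_aug_inj x : injective (env_hom (fun x => [set 0 : F x]) x).
Proof.
move=> a b ab; apply/eqP; rewrite -subr_eq0; apply/eqP/env_hom0_eq0.
by rewrite raddfB ab subrr.
Qed.

(** The image of a morphism is a family of subgroups stable under restriction, so [env_hom_eq0]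
    applies to it. *)
Lemma next_arrow_exact (s : psh_arrow) x (a : arrow_tgt s x) :
  arrow_hom (next_arrow s) x a = 0 <-> exists b, arrow_hom s x b = a.
Proof.
apply: (@env_hom_eq0 _ (@arrow_image s)) => [y|y z yz _ [b <-]].
  split=> [|_ _ [b <-] [c <-]]; first by exists 0; rewrite raddf0.
  by exists (b - c); rewrite raddfB.
by exists (psh_res _ yz b); rewrite psh_nat.
Qed.

Definition injective_res : injective_resolution F :=
  @InjectiveResolution _ P F res_obj (arrow_hom (res_arrow 0)) res_diff
    res_injective res_aug_inj (@next_arrow_exact (res_arrow 0))
    (fun n => @next_arrow_exact (res_arrow n.+1)).

End Resolution.

End EnoughInjectives.

(** * Comparison of injective resolutions *)

Section Comparison.
Variables (d : Order.disp_t) (P : porderType d).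
Implicit Types F G J : presheaf P.

(** * Image presheaves and extension of morphisms into injectives *)

Section ImagePresheaf.
Variables (A B : presheaf P) (f : psh_hom A B).

Definition im_pred x : {pred B x} := fun b => `[< exists a, f x a = b >].

Fact im_pred_closed x : zmod_closed (@im_pred x).
Proof.
split; first by apply/asboolP; exists 0; rewrite raddf0.
move=> _ _ /asboolP[a <-] /asboolP[b <-]; apply/asboolP.
by exists (a - b); rewrite raddfB.
Qed.
HB.instance Definition _ x :=
  GRing.isZmodClosed.Build (B x) (@im_pred x) (@im_pred_closed x).

Definition im_obj x : Type := {b : B x | b \in @im_pred x}.
HB.instance Definition _ x := SubChoice.on (im_obj x).
HB.instance Definition _ x := [SubChoice_isSubZmodule of im_obj x by <:].

Fact im_res_subproof x y (xy : (x <= y)%O) (b : im_obj y) :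
  psh_res B xy (val b) \in @im_pred x.
Proof.
have /asboolP[a <-] := valP b.
by apply/asboolP; exists (psh_res A xy a); rewrite psh_nat.
Qed.

Definition im_res x y (xy : (x <= y)%O) (b : im_obj y) : im_obj x :=
  exist (fun b => b \in @im_pred x) _ (im_res_subproof xy b).

Fact im_res_zmod_morphism x y (xy : (x <= y)%O) : zmod_morphism (im_res xy).
Proof. by move=> a b; apply: val_inj; rewrite /= raddfB. Qed.
HB.instance Definition _ x y (xy : (x <= y)%O) := GRing.isZmodMorphism.Build
  (im_obj y) (im_obj x) (im_res xy) (im_res_zmod_morphism xy).

Fact im_res_id x (xx : (x <= x)%O) (b : im_obj x) : im_res xx b = b.
Proof. by apply: val_inj; rewrite /= psh_res_id. Qed.

Fact im_res_comp x y z (xy : (x <= y)%O) (yz : (y <= z)%O) (xz : (x <= z)%O)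
    (b : im_obj z) : im_res xz b = im_res xy (im_res yz b).
Proof. by apply: val_inj; rewrite /= -psh_res_comp. Qed.

Definition im_psh : presheaf P :=
  @Presheaf _ P (fun x => im_obj x) (fun x y xy => im_res xy)
    im_res_id im_res_comp.

Definition im_incl : psh_hom im_psh B :=
  @PshHom _ P im_psh B (fun x => (val : im_obj x -> B x)) (fun x y xy a => erefl).

Fact im_proj_subproof x (a : A x) : f x a \in @im_pred x.
Proof. by apply/asboolP; exists a. Qed.

Definition im_proj x (a : A x) : im_psh x :=
  exist (fun b => b \in @im_pred x) _ (im_proj_subproof a).

(** Since [g] kills the kernel of [f], the value g a depends only on f a, and any preimage may be
    chosen. *)
Lemma im_hom_lift J (g : psh_hom A J) :
  (forall x a, f x a = 0 -> g x a = 0) ->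
  exists h : psh_hom im_psh J, forall x a, h x (im_proj a) = g x a.
Proof.
move=> fg.
have gE x (a b : A x) : f x a = f x b -> g x a = g x b.
  move=> ab; apply/eqP; rewrite -subr_eq0 -raddfB; apply/eqP/fg.
  by rewrite raddfB ab subrr.
have pre x (b : im_psh x) : exists a, f x a = val b by exact/asboolP/(valP b).
pose h x (b : im_psh x) : J x := g x (projT1 (cid (pre x b))).
have hE x a (b : im_psh x) : f x a = val b -> h x b = g x a.
  by move=> ab; apply: gE; rewrite ab; exact: (projT2 (cid (pre x b))).
have hB x : zmod_morphism (@h x).
  move=> b c; have [[u ub] [v vc]] := (pre x b, pre x c).
  rewrite (hE _ u b) // (hE _ v c) // (hE _ (u - v)) ?raddfB //.
  by rewrite ub vc.
have hN x y (xy : (x <= y)%O) b : mk_additive (@hB x) (psh_res im_psh xy b) =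
    psh_res J xy (mk_additive (@hB y) b).
  have [u ub] := pre y b; rewrite /= (hE _ u b) // -psh_nat.
  by apply: hE; rewrite psh_nat ub.
by exists (PshHom hN) => x a; exact: hE.
Qed.

(* J receives the map induced by g on the image of f, which embeds in B. *)
Lemma injective_psh_extend J (g : psh_hom A J) : injective_psh J ->
  (forall x a, f x a = 0 -> g x a = 0) ->
  exists h : psh_hom B J, psh_comp h f = g.
Proof.
move=> injJ /im_hom_lift[k kP].
have [|h hk] := injJ _ _ im_incl _ k; first by move=> x; exact: val_inj.
exists h; apply: psh_homP => x a.
have := congr1 (fun k : psh_hom im_psh J => k x (im_proj a)) hk.
by rewrite kP.
Qed.

End ImagePresheaf.

Lemma psh_comp_app F G J (g : psh_hom G J) (f : psh_hom F G) h x a :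
  psh_comp g f = h -> g x (f x a) = h x a.
Proof. by move=> <-. Qed.

Fact psh_sub_subproof F G (f g : psh_hom F G) x y (xy : (x <= y)%O) a :
  f x (psh_res F xy a) - g x (psh_res F xy a) = psh_res G xy (f y a - g y a).
Proof. by rewrite !psh_nat raddfB. Qed.

Definition psh_sub F G (f g : psh_hom F G) : psh_hom F G :=
  @PshHom _ P F G (fun x => f x \- g x) (psh_sub_subproof f g).

Lemma ires_diffK F (I : injective_resolution F) n x (a : I n x) :
  ires_diff I n.+1 x (ires_diff I n x a) = 0.
Proof. by apply/ires_exactS; exists a. Qed.

Lemma ires_diff_aug F (I : injective_resolution F) x (a : F x) :
  ires_diff I 0 x (ires_aug I x a) = 0.
Proof. by apply/ires_exact0; exists a. Qed.

(** * Lifting a morphism to resolutions *)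

Section Existence.
Variables (F G : presheaf P) (f : psh_hom F G).
Variables (I : injective_resolution F) (J : injective_resolution G).

(** The condition under which [ires_diff J n] after [h] extends along [ires_diff I n]. *)
Definition liftable n (h : psh_hom (I n) (J n)) : Prop :=
  forall x a, ires_diff I n x a = 0 -> ires_diff J n x (h x a) = 0.

Lemma lift0 : exists h : {h : psh_hom (I 0) (J 0) | liftable h},
  psh_comp (sval h) (ires_aug I) = psh_comp (ires_aug J) f.
Proof.
have [|h hP] := @injective_psh_extend _ _ (ires_aug I) _
    (psh_comp (ires_aug J) f) (@ires_injective _ _ _ J 0).
  move=> x a; rewrite -(raddf0 (ires_aug I x)) => /(@ires_aug_inj _ _ _ I) ->.
  exact: raddf0.
suff liftable_h : liftable h by exists (exist _ h liftable_h).
(* The kernel of the first differential is the image of the augmentation, where [hP] computes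
   [h]. *)
move=> x _ /ires_exact0[a <-].
by rewrite (psh_comp_app _ hP) ires_diff_aug.
Qed.

Lemma liftS n (h : {h : psh_hom (I n) (J n) | liftable h}) :
  exists k : {k : psh_hom (I n.+1) (J n.+1) | liftable k},
  psh_comp (sval k) (ires_diff I n) = psh_comp (ires_diff J n) (sval h).
Proof.
case: h => h liftable_h.
have [k kP] := @injective_psh_extend _ _ (ires_diff I n) _
  (psh_comp (ires_diff J n) h) (@ires_injective _ _ _ J n.+1) liftable_h.
suff liftable_k : liftable k by exists (exist _ k liftable_k).
move=> x _ /ires_exactS[a <-].
by rewrite (psh_comp_app _ kP) ires_diffK.
Qed.

(** The proof of liftability travels with the map, because the choice in the next degree depends on
    it. *)
Fixpoint lift n : {h : psh_hom (I n) (J n) | liftable h} :=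
  if n is m.+1 then projT1 (cid (liftS (lift m))) else projT1 (cid lift0).

Definition lift_map : resolution_map f I J :=
  @ResolutionMap _ _ F G f I J (fun n => sval (lift n)) (projT2 (cid lift0))
    (fun n => projT2 (cid (liftS (lift n)))).

End Existence.

(** * Uniqueness of lifts up to homotopy *)

Section Homotopy.
Variables (F G : presheaf P) (f : psh_hom F G).
Variables (I : injective_resolution F) (J : injective_resolution G).
Variables phi psi : resolution_map f I J.

Lemma rmap_diff_app (th : resolution_map f I J) n x a :
  th n.+1 x (ires_diff I n x a) = ires_diff J n x (th n x a).
Proof. exact: (psh_comp_app _ (rmap_diff th n)). Qed.

Lemma rmap_aug_app (th : resolution_map f I J) x a :
  th 0 x (ires_aug I x a) = ires_aug J x (f x a).
Proof. exact: (psh_comp_app _ (rmap_aug th)). Qed.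

(** The difference of the lifts vanishes on the image of the augmentation, which is the kernel of
    the first differential, so it factors through that differential. *)
Lemma homotopy0 : exists s : psh_hom (I 1%N) (J 0%N),
  phi 0 = psh_add (psi 0) (psh_comp s (ires_diff I 0)).
Proof.
have [|s sP] := @injective_psh_extend _ _ (ires_diff I 0) _
    (psh_sub (phi 0) (psi 0)) (@ires_injective _ _ _ J 0).
  by move=> x _ /ires_exact0[a <-] /=; rewrite !rmap_aug_app subrr.
by exists s; rewrite sP; apply: psh_homP => x a /=; rewrite addrC subrK.
Qed.

(** The hypothesis says that phi - psi - d s vanishes on the image of d, which is the kernel of the
    next differential; it therefore factors through the latter. *)
Lemma homotopyS_step n (s : psh_hom (I n.+1) (J n)) :
  (forall x a, ires_diff J n x (s x (ires_diff I n x a)) =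
    phi n.+1 x (ires_diff I n x a) - psi n.+1 x (ires_diff I n x a)) ->
  exists s' : psh_hom (I n.+2) (J n.+1),
  phi n.+1 = psh_add (psi n.+1)
    (psh_add (psh_comp s' (ires_diff I n.+1)) (psh_comp (ires_diff J n) s)).
Proof.
move=> sP; have [|s' s'P] := @injective_psh_extend _ _ (ires_diff I n.+1) _
    (psh_sub (psh_sub (phi n.+1) (psi n.+1)) (psh_comp (ires_diff J n) s))
    (@ires_injective _ _ _ J n.+1).
  by move=> x _ /ires_exactS[a <-] /=; rewrite sP subrr.
by exists s'; rewrite s'P; apply: psh_homP => x a /=; rewrite subrK addrC subrK.
Qed.

(** Only two consecutive components are kept: the induction reuses [s'] alone, and cohomology in one
    degree involves no others. *)
Lemma homotopyS n : exists (s : psh_hom (I n.+1) (J n))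
    (s' : psh_hom (I n.+2) (J n.+1)),
  phi n.+1 = psh_add (psi n.+1)
    (psh_add (psh_comp s' (ires_diff I n.+1)) (psh_comp (ires_diff J n) s)).
Proof.
elim: n => [|n [s [s' s'P]]].
  have [s sP] := homotopy0; exists s; apply: homotopyS_step => x a.
  rewrite !rmap_diff_app sP /= -raddfB; congr (ires_diff J 0 x _).
  by rewrite addrC addKr.
(* Here d (phi - psi) = d (s' d + d s) = d s' d, because d d = 0. *)
exists s'; apply: homotopyS_step => x a.
rewrite !rmap_diff_app s'P /= !raddfD /= ires_diffK addr0 addrC addKr.
by [].
Qed.

(** Additivity of [T] transports the homotopy; on a cocycle z only the coboundary d (T s z)
    survives, and in degree 0 the two maps agree on cocycles. *)
Lemma cohomology_map_unique (T : psh_functor P) i :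
  cohomology_map (functor_cochain_map T phi) (n := i) =1
  cohomology_map (functor_cochain_map T psi) (n := i).
Proof.
move=> c; rewrite -(cohomology_reprK c) !cohomology_mapE.
move: (cohomology_repr c) => {c}; case: i => [|i] z; apply/cohomology_class_eq.
  have z0 : Defs.fmap T (ires_diff I 0) (val z) = 0 := kernelP z.
  have [s sP] := homotopy0.
  by rewrite /= sP Defs.fmap_add Defs.fmap_comp z0 raddf0 addr0 subrr.
have z0 : Defs.fmap T (ires_diff I i.+1) (val z) = 0 := kernelP z.
have [s [s' sP]] := homotopyS i; exists (Defs.fmap T s (val z)).
by rewrite /= sP !Defs.fmap_add !Defs.fmap_comp z0 raddf0 add0r addrC addKr.
Qed.

End Homotopy.

End Comparison.

(** * Derived functors *)

Section DerivedFunctors.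
Variables (d : Order.disp_t) (P : porderType d).
Implicit Types F G K : presheaf P.

Lemma psh_comp1f F G (f : psh_hom F G) : psh_comp (psh_id G) f = f.
Proof. exact: psh_homP. Qed.

Lemma psh_compf1 F G (f : psh_hom F G) : psh_comp f (psh_id F) = f.
Proof. exact: psh_homP. Qed.

Definition rmap_id F (I : injective_resolution F) :
    resolution_map (psh_id F) I I :=
  @ResolutionMap _ _ F F (psh_id F) I I (fun n => psh_id (I n))
    (etrans (psh_comp1f _) (esym (psh_compf1 _)))
    (fun n => etrans (psh_comp1f _) (esym (psh_compf1 _))).

Section RmapOperations.
Variables (F G K : presheaf P) (I : injective_resolution F).
Variables (J : injective_resolution G) (L : injective_resolution K).

Section Comp.
Variables (g : psh_hom G K) (f : psh_hom F G).
Variables (psi : resolution_map g J L) (phi : resolution_map f I J).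

Fact rmap_comp_aug : psh_comp (psh_comp (psi 0) (phi 0)) (ires_aug I) =
  psh_comp (ires_aug L) (psh_comp g f).
Proof. by apply: psh_homP => x a; rewrite /= !rmap_aug_app. Qed.

Fact rmap_comp_diff n :
  psh_comp (psh_comp (psi n.+1) (phi n.+1)) (ires_diff I n) =
  psh_comp (ires_diff L n) (psh_comp (psi n) (phi n)).
Proof. by apply: psh_homP => x a; rewrite /= !rmap_diff_app. Qed.

Definition rmap_comp : resolution_map (psh_comp g f) I L :=
  @ResolutionMap _ _ _ _ _ I L (fun n => psh_comp (psi n) (phi n))
    rmap_comp_aug rmap_comp_diff.

End Comp.

Section Add.
Variables (f g : psh_hom F G).
Variables (phi : resolution_map f I J) (psi : resolution_map g I J).

Fact rmap_add_aug : psh_comp (psh_add (phi 0) (psi 0)) (ires_aug I) =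
  psh_comp (ires_aug J) (psh_add f g).
Proof. by apply: psh_homP => x a; rewrite /= !rmap_aug_app raddfD. Qed.

Fact rmap_add_diff n : psh_comp (psh_add (phi n.+1) (psi n.+1)) (ires_diff I n) =
  psh_comp (ires_diff J n) (psh_add (phi n) (psi n)).
Proof. by apply: psh_homP => x a; rewrite /= !rmap_diff_app raddfD. Qed.

Definition rmap_add : resolution_map (psh_add f g) I J :=
  @ResolutionMap _ _ _ _ _ I J (fun n => psh_add (phi n) (psi n))
    rmap_add_aug rmap_add_diff.

End Add.
End RmapOperations.

Variables (T : psh_functor P) (i : nat).

Definition Rgroup F (I : injective_resolution F) : zmodType :=
  cohomology (functor_complex T I) i.

Definition Rmap F G (f : psh_hom F G) (I : injective_resolution F)
    (J : injective_resolution G) : {additive Rgroup I -> Rgroup J} :=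
  @cohomology_map _ _ (functor_cochain_map T (lift_map f I J)) i.

(** Any resolution map may replace the chosen lift, so functoriality and additivity follow by taking
    identities, composites and sums of resolution maps. *)
Lemma RmapE F G (I : injective_resolution F) (J : injective_resolution G)
    (f : psh_hom F G) (phi : resolution_map f I J) (c : Rgroup I) :
  Rmap f I J c = cohomology_map (functor_cochain_map T phi) c.
Proof. exact: cohomology_map_unique. Qed.

Lemma Rmap_id F (I : injective_resolution F) (c : Rgroup I) : Rmap (psh_id F) I I c = c.
Proof.
rewrite (RmapE (rmap_id I)) -(cohomology_reprK c) cohomology_mapE.
by congr cohomology_class; apply: val_inj; rewrite /= Defs.fmap_id.
Qed.

Section RmapTheory.
Variables (F G K : presheaf P) (I : injective_resolution F).
Variables (J : injective_resolution G) (L : injective_resolution K).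

Lemma Rmap_comp (g : psh_hom G K) (f : psh_hom F G) (c : Rgroup I) :
  Rmap (psh_comp g f) I L c = Rmap g J L (Rmap f I J c).
Proof.
rewrite (RmapE (rmap_comp (lift_map g J L) (lift_map f I J))).
rewrite -(cohomology_reprK c) cohomology_mapE.
rewrite [Rmap f I J _]cohomology_mapE [RHS]cohomology_mapE.
by congr cohomology_class; apply: val_inj; rewrite /= Defs.fmap_comp.
Qed.

Lemma Rmap_add (f g : psh_hom F G) (c : Rgroup I) :
  Rmap (psh_add f g) I J c = Rmap f I J c + Rmap g I J c.
Proof.
rewrite (RmapE (rmap_add (lift_map f I J) (lift_map g I J))).
rewrite -(cohomology_reprK c) cohomology_mapE.
rewrite [Rmap f I J _]cohomology_mapE [Rmap g I J _]cohomology_mapE -raddfD.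
by congr cohomology_class; apply: val_inj; rewrite /= Defs.fmap_add.
Qed.

End RmapTheory.

Lemma Rmap_id_bij F (I J : injective_resolution F) :
  bijective (Rmap (psh_id F) I J).
Proof.
by exists (Rmap (psh_id F) J I) => c; rewrite -Rmap_comp psh_comp1f Rmap_id.
Qed.

Definition derived_functor : psh_functor P :=
  @PshFunctor _ P (fun F => Rgroup (injective_res F))
    (fun F G f => Rmap f (injective_res F) (injective_res G))
    (fun F => @Rmap_id F (injective_res F))
    (fun F G K => @Rmap_comp F G K _ _ _) (fun F G => @Rmap_add F G _ _).

(** The comparison with an arbitrary resolution is induced by the identity of [F]; both sides of the
    naturality square then reduce to the map induced by [f]. *)
Lemma derived_functorP : is_right_derived T i derived_functor.
Proof.
exists (fun F I => Rmap (psh_id F) (injective_res F) I).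
split=> [F I|F G f I J phi c]; first exact: Rmap_id_bij.
by rewrite -RmapE -!Rmap_comp psh_comp1f psh_compf1.
Qed.

Lemma bijective_additive_inv (A B : zmodType) (f : {additive A -> B}) :
  bijective f -> exists g : {additive B -> A}, cancel f g /\ cancel g f.
Proof.
move=> [g fK gK].
have gB : zmod_morphism g.
  by move=> x y; apply: (can_inj fK); rewrite raddfB !gK.
by exists (mk_additive gB).
Qed.

(** Both functors are identified with the cohomology of the same resolution [injective_res F]; one
    identification followed by the inverse of the other is natural, as both respect the lift of
    [f]. *)
Lemma right_derived_unique (R R' : psh_functor P) :
  is_right_derived T i R -> is_right_derived T i R' -> psh_functor_iso R R'.
Proof.
move=> [e [e_bij e_nat]] [e' [e'_bij e'_nat]].
have inv F := cid (bijective_additive_inv (e'_bij F (injective_res F))).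
exists (fun F => projT1 (inv F) \o e F (injective_res F)).
split=> [F|F G f c].
  have [invK Kinv] := projT2 (inv F).
  by apply: bij_comp; [exists (e' F (injective_res F))|exact: e_bij].
have [invK _] := projT2 (inv G); have [_ Kinv] := projT2 (inv F).
rewrite /= (e_nat _ _ _ _ _ (lift_map f (injective_res F) (injective_res G))).
by rewrite -[in LHS](Kinv (e F _ c)) -e'_nat invK.
Qed.

End DerivedFunctors.

Lemma group_iso_trans (A B C : zmodType) :
  group_iso A B -> group_iso B C -> group_iso A C.
Proof. by move=> [f f_bij] [g g_bij]; exists (g \o f); exact: bij_comp. Qed.

Lemma group_iso_sym (A B : zmodType) : group_iso A B -> group_iso B A.
Proof.
by move=> [f /bijective_additive_inv[g [fK gK]]]; exists g; exists f.
Qed.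

Lemma poset_cohomology_unique (d : Order.disp_t) (P : porderType d)
    (F : presheaf P) p (H H' : zmodType) :
  is_poset_cohomology F p H -> is_poset_cohomology F p H' -> group_iso H H'.
Proof.
move=> [R Rder HR] [R' R'der H'R'].
have [e [e_bij _]] := right_derived_unique Rder R'der.
apply: (group_iso_trans HR); apply: (group_iso_trans _ (group_iso_sym H'R')).
by exists (e F).
Qed.

(** * Cellular cohomology and rank *)

(** A connecting class is represented by the differential of a cochain b on [Q], so it becomes a
    coboundary in the absolute complex. *)
Lemma HS_rel_incl_connecting (d : Order.disp_t) (P : porderType d)
    (Q Q' : {pred P}) (Q'Q : {subset Q' <= Q}) (F : presheaf P) n
    (c : cohomology (S_complex Q' F) n) :
  HS_rel_incl Q'Q F n.+1 (HS_connecting Q'Q F n c) = 0.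
Proof.
rewrite -(cohomology_reprK c).
have [b pb] := S_res_surj Q'Q (val (cohomology_repr c)).
rewrite /HS_connecting /HS_rel_incl /= (connectingE _ pb) cohomology_mapE.
rewrite -(raddf0 (@cohomology_class _ _)); apply/cohomology_class_eq.
by exists b; rewrite subr0.
Qed.

Lemma cell_diffK (d : Order.disp_t) (P : porderType d) (crk : P -> int)
    (F : presheaf P) n (u : cell_group crk F n) :
  cell_diff crk F n.+1 (cell_diff crk F n u) = 0.
Proof. by rewrite /cell_diff /= HS_rel_incl_connecting raddf0. Qed.

(** * The rank function given by cardinality *)

Section Rank.
Variables (X : topologicalType) (A : Type) (S : structured_space X A).
Hypothesis finS : finite_set (sdom S).

(** Finiteness matters because [fset_set] returns a default value on infinite sets. *)
Lemma finite_hquot (p : assoc_poset S) : finite_set (hquot p).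
Proof. by apply: sub_finite_set finS => U []. Qed.

Lemma assoc_leP (p q : assoc_poset S) :
  reflect (hquot p `<=` hquot q) (p <= q)%O.
Proof. exact: asboolP. Qed.

Lemma hquot_inj (p q : assoc_poset S) : hquot p = hquot q -> p = q.
Proof. by move=> pq; apply/le_anti/andP; split; apply/assoc_leP; rewrite pq. Qed.

Lemma card_rank_lt (p q : assoc_poset S) : (p < q)%O -> card_rank p < card_rank q.
Proof.
rewrite lt_neqAle => /andP[pq /assoc_leP hpq]; rewrite ltz_nat.
apply: fproper_ltn_card; rewrite fproperEneq; apply/andP; split.
  apply: contra_neq pq => /(fset_set_inj (finite_hquot p) (finite_hquot q)).
  exact: hquot_inj.
by rewrite -(fset_set_sub (finite_hquot p) (finite_hquot q)).
Qed.

Lemma card_rank_le_sdom (p : assoc_poset S) :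
  card_rank p <= #|` fset_set (sdom S)|%:Z.
Proof.
rewrite lez_nat; apply: fsubset_leq_card.
by rewrite -(fset_set_sub (finite_hquot p) finS) => U [].
Qed.

Hypothesis surjS : set_surj [set: X] (nonempty_subcollections S) (hmap S).

Lemma card_rank_covers (p q : assoc_poset S) :
  covers p q -> card_rank q = card_rank p + 1.
Proof.
move=> [pq cov]; have /assoc_leP hpq := ltW pq.
have [U qU npU] : exists2 U, hquot q U & ~ hquot p U.
  apply: contrapT => nex; move: pq; rewrite lt_neqAle => /andP[/eqP pq _].
  apply/pq/hquot_inj/seteqP; split=> // U qU.
  by apply: contrapT => npU; apply: nex; exists U.
(* The class of this x lies between p and q and differs from p because of [U]; hence it is q, and
   h(q) is h(p) with [U] added. *)
have [x _ hx] : (hmap S @` setT) (U |` hquot p).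
  apply: surjS; split; last by exists U; left.
  by move=> V [->|[]] //; case: qU.
have [xp|xq] : assoc_class S x = p \/ assoc_class S x = q.
- apply: cov; apply/assoc_leP; rewrite hquotE hx => V; first by right.
  by case=> [->|/hpq].
- by case: npU; rewrite -xp hquotE hx; left.
rewrite /card_rank -xq hquotE hx (fset_setU1 _ (finite_hquot p)) cardfsU1.
rewrite (in_fset_set (finite_hquot p)) (memNset npU) addrC.
by rewrite -PoszD.
Qed.

Lemma card_rank_is_rank : is_rank_function (@card_rank X A S).
Proof. by split; [exact: card_rank_lt|exact: card_rank_covers]. Qed.

Lemma card_rank_bounded : bounded_above (@card_rank X A S).
Proof. by exists #|` fset_set (sdom S)|%:Z; exact: card_rank_le_sdom. Qed.

Lemma card_rank_corank : [set: X] !=set0 ->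
  exists crk, is_corank_function (@card_rank X A S) crk.
Proof.
move=> [x0 _]; set r : int := #|` fset_set (sdom S)|%:Z.
exists (fun p => r - card_rank p), r; split=> //; last exact: card_rank_le_sdom.
(* The bound is attained: as x0 is covered, the whole collection is nonempty, and surjectivity
   realises it as some h(x). *)
have [x _ hx] : (hmap S @` setT) (sdom S).
  by apply: surjS; split=> //; have [U SU _] := sdom_cover S x0; exists U.
by exists (assoc_class S x); rewrite /card_rank hquotE hx.
Qed.

End Rank.

Theorem theorem3p1 (X : topologicalType) (A : Type) (S : structured_space X A)
    (X_nonempty : [set: X] !=set0) (F : presheaf (assoc_poset S)) :
  [/\ (* (1) *)
      [/\ forall G : presheaf (assoc_poset S), inhabited (injective_resolution G),
          forall i : nat, exists R : psh_functor (assoc_poset S),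
            is_right_derived (psh_lim (assoc_poset S)) i R /\
            (forall R' : psh_functor (assoc_poset S),
               is_right_derived (psh_lim (assoc_poset S)) i R' ->
               psh_functor_iso R R')
        & forall p : nat, exists H : zmodType,
            is_poset_cohomology F p H /\
            (forall H' : zmodType, is_poset_cohomology F p H' ->
               group_iso H H')],
      (* (2) *)
      finite_set (sdom S) ->
      set_surj [set: X] (nonempty_subcollections S) (hmap S) ->
      [/\ forall x : X,
            card_rank (assoc_class S x) = #|` fset_set (hmap S x)|%:Z,
          is_rank_function (@card_rank X A S),
          bounded_above (@card_rank X A S),
          is_graded (assoc_poset S)
        & exists crk : assoc_poset S -> int,
            is_corank_function (@card_rank X A S) crk]
    & (* (3) *)
      finite_set (sdom S) ->
      set_surj [set: X] (nonempty_subcollections S) (hmap S) ->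
      forall crk : assoc_poset S -> int,
        is_corank_function (@card_rank X A S) crk ->
        forall (n : nat) (u : cell_group crk F n),
          cell_diff crk F n.+1 (cell_diff crk F n u) = 0].

Proof.
split.
- split.
  + by move=> G; constructor; exact: injective_res.
  + move=> i; exists (derived_functor (psh_lim _) i).
    split; first exact: derived_functorP.
    by move=> R'; apply: right_derived_unique; exact: derived_functorP.
  + move=> p; exists (derived_functor (psh_lim _) p F).
    have H : is_poset_cohomology F p (derived_functor (psh_lim _) p F).
      exists (derived_functor (psh_lim _) p); first exact: derived_functorP.
      by exists idfun; exists idfun.
    by split=> // H'; exact: poset_cohomology_unique.
- move=> finS surjS; split.
  + by move=> x; rewrite /card_rank hquotE.
  + exact: card_rank_is_rank.
  + exact: card_rank_bounded.
  + by exists (@card_rank X A S); exact: card_rank_is_rank.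
  + exact: card_rank_corank.
- by move=> _ _ crk _ n u; exact: cell_diffK.
Qed.
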